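(* Suppose that $W_{\boldsymbol\lambda}$ is a conditionally positive definite (CPD) unilateral weighted shift with weights $\boldsymbol\lambda=\{\lambda_n\}_{n=0}^\infty$ such that $$\lambda_0=\lambda_1=\lambda_2=\lambda_3\neq1.$$ Then $\frac{1}{\lambda_0}W_{\boldsymbol\lambda}$ is the unilateral shift.
   Context: A real sequence $\{\gamma_n\}_{n=0}^\infty$ is CPD if $\sum_{i,j=0}^k \gamma_{i+j}\alpha_i\bar\alpha_j\geq 0$ for every finite sequence $\alpha_0,\dots,\alpha_k\in\mathbb{C}$ with $\sum_{j=0}^k\alpha_j=0$. A bounded operator $T$ on a complex Hilbert space $\mathcal{H}$ is CPD if $\{\|T^nh\|^2\}_{n=0}^\infty$ is CPD for every $h\in\mathcal{H}$. For a bounded sequence $\boldsymbol\lambda=\{\lambda_n\}_{n=0}^\infty$ of positive reals, $W_{\boldsymbol\lambda}$ is the bounded operator on $\ell^2$ with $W_{\boldsymbol\lambda}e_n=\lambda_ne_{n+1}$ for $n\geq0$ ($\{e_n\}$ the standard orthonormal basis). The unilateral shift is $W_{\boldsymbol\lambda}$ with $\lambda_n=1$ for all $n\geq0$. *)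

(* Defs.v *)
From HB Require Import structures.
From mathcomp Require Import all_boot all_order all_algebra.
From mathcomp Require Import all_classical all_reals all_analysis.
From mathcomp Require Import complex.
From mathcomp Require Import ring lra.

Set Implicit Arguments.
Unset Strict Implicit.
Unset Printing Implicit Defensive.

Import Order.TTheory GRing.Theory Num.Theory.
Import numFieldNormedType.Exports.
Import Normc.

Local Open Scope classical_set_scope.
Local Open Scope ring_scope.
Local Open Scope complex_scope.

Section nonneg_series.
Variable R : realType.
Implicit Types u v : R^nat.

Lemma nneg_series_le u n : (forall k, 0 <= u k) -> cvgn (series u) ->
  series u n <= limn (series u).
Proof.
move=> u0 cu; apply: nondecreasing_cvgn_le => //.
by apply/nondecreasing_seqP => m; rewrite seriesSr lerDl.
Qed.

Lemma nneg_series_bounded u M : (forall k, 0 <= u k) ->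
  (forall n, series u n <= M) ->
  cvgn (series u) /\ limn (series u) <= M.
Proof.
move=> u0 uM.
have cu : cvgn (series u).
  apply: nondecreasing_is_cvgn.
    by apply/nondecreasing_seqP => m; rewrite seriesSr lerDl.
  by exists M => _ [n _ <-].
by split => //; apply: limr_le => //; near=> n; exact: uM.
Unshelve. all: by end_near. Qed.

Lemma nneg_series_ge0 u : (forall k, 0 <= u k) -> cvgn (series u) ->
  0 <= limn (series u).
Proof.
by move=> u0 cu; apply: le_trans (nneg_series_le 0%N u0 cu); rewrite /series /= big_geq.
Qed.

End nonneg_series.

Section l2_space.
Variable R : realType.
Local Notation C := R[i].
Implicit Types (x y : nat -> C).

(* [normc] is the modulus with values in [R]; the norm [`|_|] of [R[i]] has
   its values in [R[i]]. *)
Definition sqmod x : R^nat := fun n => normc (x n) ^+ 2.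

Definition square_summable : {pred (nat -> C)} :=
  mem [set x | cvgn (series (sqmod x))].

Lemma square_summableP x : reflect (cvgn (series (sqmod x))) (x \in square_summable).
Proof. by apply: (iffP idP); rewrite inE. Qed.

Lemma sqmod_ge0 x n : 0 <= sqmod x n.
Proof. exact: sqr_ge0. Qed.

Lemma sqmodE x n : sqmod x n = complex.Re (x n) ^+ 2 + complex.Im (x n) ^+ 2.
Proof.
rewrite /sqmod; case: (x n) => a b /=.
by rewrite sqr_sqrtr// addr_ge0// sqr_ge0.
Qed.

Lemma sqmodD x y (s t : R) n : 0 < t -> s * t = 1 ->
  sqmod (x + y) n <= (1 + t) * sqmod x n + (1 + s) * sqmod y n.
Proof.
move=> t0 st; rewrite !sqmodE /=.
have -> : (x + y) n = x n + y n by [].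
case: (x n) => a b; case: (y n) => c d /=.
have s0 : 0 < s by rewrite -(pmulr_lgt0 _ t0) st.
have k (p q : R) : 2 * (p * q) <= t * p ^+ 2 + s * q ^+ 2.
  have : 0 <= s * (t * p - q) ^+ 2 by rewrite mulr_ge0 ?sqr_ge0// ltW.
  have -> : s * (t * p - q) ^+ 2 =
    (s * t) * t * p ^+ 2 - 2 * (s * t) * (p * q) + s * q ^+ 2 by ring.
  rewrite st; lra.
have := k a c; have := k b d; lra.
Qed.

Lemma series_sqmodD x y (s t : R) n : 0 < t -> s * t = 1 ->
  series (sqmod (x + y)) n
    <= (1 + t) * series (sqmod x) n + (1 + s) * series (sqmod y) n.
Proof.
move=> t0 st; rewrite /series /= !mulr_sumr -big_split /=.
by apply: ler_sum => i _; exact: sqmodD.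
Qed.

Lemma sqmodZ (a : C) x n : sqmod (a *: x) n = normc a ^+ 2 * sqmod x n.
Proof.
by rewrite /sqmod; have -> : (a *: x) n = a * x n by []; rewrite normcM exprMn.
Qed.

Lemma series_sqmodZ (a : C) x : series (sqmod (a *: x)) = normc a ^+ 2 *: series (sqmod x).
Proof.
apply/funext => n; rewrite /series /=.
have -> : (normc a ^+ 2 *: (fun n => \sum_(0 <= k < n) sqmod x k)) n
   = normc a ^+ 2 * \sum_(0 <= k < n) sqmod x k by [].
by rewrite mulr_sumr; apply: eq_bigr => i _; rewrite sqmodZ.
Qed.

Fact square_summable_submod_closed : submod_closed square_summable.
Proof.
split=> [|a x y /square_summableP cx /square_summableP cy]; apply/square_summableP.
  have -> : series (sqmod 0) = fun=> 0.
    apply/funext => n; rewrite /series /= big1// => i _.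
    by rewrite sqmodE /= expr0n addr0.
  exact: is_cvg_cst.
have cax : cvgn (series (sqmod (a *: x))).
  by rewrite series_sqmodZ; exact: is_cvgZl_tmp.
have [] // := @nneg_series_bounded R (sqmod (a *: x + y))
  ((1 + 1) * limn (series (sqmod (a *: x))) + (1 + 1) * limn (series (sqmod y))).
  exact: sqmod_ge0.
move=> n; apply: le_trans (@series_sqmodD (a *: x) y 1 1 n ltr01 (mulr1 1)) _.
by rewrite lerD// ler_pM2l ?addr_gt0 ?ltr01//; apply: nneg_series_le => // k; exact: sqmod_ge0.
Qed.

HB.instance Definition _ := GRing.isSubmodClosed.Build C (nat -> C) square_summable
  square_summable_submod_closed.

Record l2 := L2 { l2_fun :> nat -> C; l2P : l2_fun \in square_summable }.

HB.instance Definition _ := [isSub for l2_fun].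
HB.instance Definition _ := [Choice of l2 by <:].
HB.instance Definition _ := [SubChoice_isSubLmodule of l2 by <:].

Lemma l2_cvg (x : l2) : cvgn (series (sqmod x)).
Proof. exact/square_summableP/l2P. Qed.

Lemma l2_ext (x y : l2) : (forall n, x n = y n) -> x = y.
Proof. by move=> xy; apply/val_inj/funext. Qed.

Lemma l2DE (x y : l2) n : (x + y) n = x n + y n. Proof. by []. Qed.
Lemma l2ZE (a : C) (x : l2) n : (a *: x) n = a * x n. Proof. by []. Qed.

Definition l2_norm (x : l2) : R := Num.sqrt (limn (series (sqmod x))).

Lemma l2_norm_ge0 (x : l2) : 0 <= l2_norm x. Proof. exact: sqrtr_ge0. Qed.

Lemma l2_norm_sq (x : l2) : l2_norm x ^+ 2 = limn (series (sqmod x)).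
Proof. rewrite sqr_sqrtr// nneg_series_ge0//; [exact: sqmod_ge0|exact: l2_cvg]. Qed.

Lemma l2_norm_coord (x : l2) n : normc (x n) <= l2_norm x.
Proof.
rewrite -ler_sqr ?nnegrE ?l2_norm_ge0 ?sqrtr_ge0//; last first.
  by case: (x n) => a b /=; exact: sqrtr_ge0.
rewrite l2_norm_sq; apply: le_trans (nneg_series_le n.+1 (sqmod_ge0 x) (@l2_cvg x)).
rewrite seriesSr lerDr /series /=; apply: sumr_ge0 => i _; exact: sqmod_ge0.
Qed.

Lemma l2_norm_eq0 (x : l2) : l2_norm x = 0 -> x = 0.
Proof.
move=> x0; apply: l2_ext => n; apply: eq0_normc; apply/eqP.
rewrite eq_le -{1}x0 l2_norm_coord /=.
by case: (x n) => a b /=; exact: sqrtr_ge0.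
Qed.

Lemma l2_norm_le (x : l2) (M : R) : 0 <= M ->
  (forall n, series (sqmod x) n <= M ^+ 2) -> l2_norm x <= M.
Proof.
move=> M0 xM; rewrite -ler_sqr ?nnegrE ?l2_norm_ge0// l2_norm_sq.
exact: (nneg_series_bounded (sqmod_ge0 x) xM).2.
Qed.

Lemma l2_normD (x y : l2) : l2_norm (x + y) <= l2_norm x + l2_norm y.
Proof.
have [x0|xn0] := eqVneq (l2_norm x) 0; first by rewrite x0 (l2_norm_eq0 x0) !add0r.
have [y0|yn0] := eqVneq (l2_norm y) 0; first by rewrite y0 (l2_norm_eq0 y0) !addr0.
have x_gt0 : 0 < l2_norm x by rewrite lt_def xn0 l2_norm_ge0.
have y_gt0 : 0 < l2_norm y by rewrite lt_def yn0 l2_norm_ge0.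
apply: l2_norm_le => [|n]; first by rewrite addr_ge0 ?l2_norm_ge0.
set A := l2_norm x in xn0 x_gt0 *; set B := l2_norm y in yn0 y_gt0 *.
have BA : 0 < B / A by rewrite divr_gt0.
have AB : 0 < A / B by rewrite divr_gt0.
have st : A / B * (B / A) = 1 by field; rewrite xn0 yn0.
apply: le_trans (series_sqmodD x y n BA st) _.
have -> : (A + B) ^+ 2 = (1 + B / A) * A ^+ 2 + (1 + A / B) * B ^+ 2.
  by field; rewrite xn0 yn0.
rewrite lerD// ler_pM2l ?addr_gt0// l2_norm_sq nneg_series_le//;
  [exact: sqmod_ge0|exact: l2_cvg|exact: sqmod_ge0|exact: l2_cvg].
Qed.

Lemma l2_normZ (a : C) (x : l2) : l2_norm (a *: x) = normc a * l2_norm x.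
Proof.
rewrite /l2_norm series_sqmodZ limZr; last exact: l2_cvg.
rewrite sqrtrM ?sqr_ge0// sqrtr_sqr ger0_norm//.
by case: a => a b; exact: sqrtr_ge0.
Qed.

Definition l2_normC (x : l2) : C := (l2_norm x)%:C.

Fact l2_normCD (x y : l2) : l2_normC (x + y) <= l2_normC x + l2_normC y.
Proof. by rewrite /l2_normC -rmorphD lecR l2_normD. Qed.

Fact l2_normCZ (a : C) (x : l2) : l2_normC (a *: x) = `|a| * l2_normC x.
Proof. by rewrite /l2_normC l2_normZ rmorphM. Qed.

Fact l2_normC_eq0 (x : l2) : l2_normC x = 0 -> x = 0.
Proof. by move=> /(congr1 (@complex.Re R)) /l2_norm_eq0. Qed.

HB.instance Definition _ := isPointed.Build l2 0.
HB.instance Definition _ := Lmodule_isNormed.Build C l2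
  l2_normCD l2_normCZ l2_normC_eq0.

Lemma l2_normE (x : l2) :
  `|x| = (Num.sqrt (limn (series (fun n => normc (x n) ^+ 2))))%:C.
Proof. by []. Qed.

Fact l2_basis_subproof n : (fun k => (k == n)%:R : C) \in square_summable.
Proof.
apply/square_summableP.
have h k : 0 <= sqmod (fun k => (k == n)%:R : C) k by exact: sqmod_ge0.
have [] // := @nneg_series_bounded R _ 1 h => m.
rewrite /series /= -(@big_mkcond _ _ _ _ _ predT) /=.
under eq_bigr => i _ do rewrite sqmodE.
have [nm|mn] := ltnP n m.
  rewrite (bigD1_seq n) ?mem_index_iota ?iota_uniq//= eqxx /= expr1n expr0n addr0.
  by rewrite big1 ?addr0// => i /negbTE -> /=; rewrite expr0n addr0.
rewrite big_nat big1 ?ler01// => i /andP[_ im].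
by rewrite ltn_eqF ?(leq_trans im)//= expr0n addr0.
Qed.

Definition l2_basis n : l2 := L2 (l2_basis_subproof n).

End l2_space.

Arguments l2_basis {R} n.

Section weighted_shift.
Variable R : realType.
Implicit Types (l : R^nat).

Definition wshift_seq l (x : nat -> R[i]) : nat -> R[i] :=
  fun n => if n is m.+1 then (l m)%:C * x m else 0.

Lemma series_sqmod_wshift l (M : R) (x : nat -> R[i]) n :
  (forall k, `|l k| <= M) ->
  series (sqmod (wshift_seq l x)) n <= M ^+ 2 * series (sqmod x) n.
Proof.
move=> lM; case: n => [|n]; first by rewrite /series /= !big_geq// mulr0.
rewrite {1}/series /= big_nat_recl// [X in X + _](_ : _ = 0) ?add0r; last first.
  by rewrite sqmodE /= expr0n addr0.
rewrite seriesSr mulrDr [leLHS](_ : _ = \sum_(0 <= i < n) `|l i| ^+ 2 * sqmod x i).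
  rewrite /series /= mulr_sumr; apply: le_trans (_ : \sum_(0 <= i < n) M ^+ 2 * sqmod x i <= _).
    apply: ler_sum => i _; rewrite ler_wpM2r ?sqmod_ge0//.
    by rewrite ler_sqr ?nnegrE// (le_trans _ (lM i)).
  by rewrite lerDl mulr_ge0 ?sqr_ge0 ?sqmod_ge0.
apply: eq_bigr => i _; rewrite /sqmod /= normcM exprMn; congr (_ * _).
by rewrite /normc /= expr0n addr0 sqr_sqrtr ?sqr_ge0// real_normK ?num_real.
Qed.

Lemma bounded_weightsP l : bounded_fun l -> exists M : R, forall n, `|l n| <= M.
Proof. by move=> /pinfty_ex_gt0[M _ lM]; exists M => n; exact: lM. Qed.

Fact wshift_subproof l : bounded_fun l ->
  forall x : l2 R, wshift_seq l x \in @square_summable R.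
Proof.
move=> /bounded_weightsP[M lM] x; apply/square_summableP.
have [] // := @nneg_series_bounded R (sqmod (wshift_seq l x))
  (M ^+ 2 * limn (series (sqmod x))) (sqmod_ge0 _).
move=> n; apply: le_trans (series_sqmod_wshift x n _) _; first by move=> k; exact: lM.
rewrite ler_wpM2l ?sqr_ge0//; apply: nneg_series_le; [exact: sqmod_ge0|exact: l2_cvg].
Qed.

(* The bounded operator (see [wshift_norm_le]) determined by its action on the
   basis, [wshift_basis]: (x_0, x_1, ...) |-> (0, l_0 x_0, l_1 x_1, ...). *)
Definition wshift l (lb : bounded_fun l) (x : l2 R) : l2 R :=
  L2 (wshift_subproof lb x).

Lemma wshift_basis l (lb : bounded_fun l) n :
  wshift lb (l2_basis n) = (l n)%:C *: l2_basis n.+1.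
Proof.
apply: l2_ext => -[|m]; rewrite l2ZE /= ?mulr0//.
by rewrite eqSS; have [->//|] := eqVneq m n; rewrite !mulr0.
Qed.

Fact wshift_linear l (lb : bounded_fun l) : linear (wshift lb).
Proof.
move=> a x y; apply: l2_ext => -[|n]; rewrite l2DE l2ZE /= ?mulr0 ?addr0//.
by transitivity ((l n)%:C * (a * x n + y n)) => //; rewrite mulrDr mulrCA.
Qed.

HB.instance Definition _ l (lb : bounded_fun l) :=
  GRing.isLinear.Build R[i] (l2 R) (l2 R) *:%R (wshift lb) (wshift_linear lb).

Lemma wshift_norm_le l (lb : bounded_fun l) :
  exists2 M : R, 0 <= M & forall x : l2 R, `|wshift lb x| <= M%:C * `|x|.
Proof.
have [M lM] := bounded_weightsP lb.
have M0 : 0 <= M by rewrite (le_trans (normr_ge0 _) (lM 0%N)).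
exists M => // x; rewrite /Num.norm /= /l2_normC -rmorphM lecR.
apply: l2_norm_le => [|n]; first by rewrite mulr_ge0// l2_norm_ge0.
rewrite exprMn l2_norm_sq; apply: le_trans (series_sqmod_wshift x n _) _.
  by move=> k; exact: lM.
rewrite ler_wpM2l ?sqr_ge0//; apply: nneg_series_le; [exact: sqmod_ge0|exact: l2_cvg].
Qed.

Lemma wshift_continuous l (lb : bounded_fun l) : continuous (wshift lb).
Proof.
have [M M0 lM] := wshift_norm_le lb.
apply/bounded_linear_continuous/linear_boundedP; near=> r => x.
apply: le_trans (lM x) _; rewrite ler_wpM2r//.
by near: r; apply: nbhs_pinfty_ge; rewrite ger0_real// (lecR 0 M).
Unshelve. all: by end_near. Qed.

Fact unit_weights_bounded : bounded_fun (fun _ : nat => 1 : R).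
Proof. exact: bounded_cst. Qed.

Definition unilateral_shift : l2 R -> l2 R := wshift unit_weights_bounded.

End weighted_shift.

Arguments unilateral_shift R : clear implicits.

Section cpd.
Variable R : realType.

(* In [R[i]], [0 <= z] means that [z] is real and nonnegative. *)
Definition cpd_seq (g : R^nat) : Prop :=
  forall (k : nat) (a : 'I_k.+1 -> R[i]), \sum_(i < k.+1) a i = 0 ->
    0 <= \sum_(i < k.+1) \sum_(j < k.+1) (g (i + j)%N)%:C * a i * (a j)^*.

(* The condition involves the norm of the space only, so it is stated for any
   complex normed space; that norm is [R[i]]-valued, with zero imaginary part. *)
Definition cpd_operator (V : normedModType R[i]) (T : {linear V -> V}) : Prop :=
  forall h : V, cpd_seq (fun n => complex.Re `|iter n T h| ^+ 2).

End cpd.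

(* Main.v *)
Require Import Defs.
From HB Require Import structures.
From mathcomp Require Import all_boot all_order all_algebra.
From mathcomp Require Import all_classical all_reals all_analysis.
From mathcomp Require Import complex.
From mathcomp Require Import ring lra.

Import Order.TTheory GRing.Theory Num.Theory.
Import numFieldNormedType.Exports.

Local Open Scope classical_set_scope.
Local Open Scope ring_scope.
Local Open Scope complex_scope.

(** Evaluating the CPD condition at the basis vector e_0 is enough.  There the
    sequence g n = |W^n e_0|^2 is the square of the product of the first n
    weights, and with a = lambda_0^2 the four equal weights give g n = a^n for
    n <= 4.  The claim is that a CPD sequence with such a beginning is a^n
    throughout ([cpd_geometric]).

    Let L be the linear functional on real polynomials that sends X^n to g n.
    Conditional positive definiteness says that L(p^2) >= 0 for the polynomials
    p vanishing at 1, so (p, q) |-> L(p q) is a positive semidefinite form on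
    the ideal (X - 1) and, as for every such form, a vector of square zero is
    orthogonal to the whole ideal ([cpd_orthogonal]).  Up to degree 4 the
    functional L is evaluation at a; hence p = (X - 1)(X - a) is such a vector.
    Its orthogonality to X^n (X - 1) is a linear recurrence of order three,
    with characteristic polynomial (X - 1)^2 (X - a).  The sequence a^n
    satisfies the same recurrence and has the same first three terms.

    Finally, all partial products of the weights are powers of lambda_0, so all
    weights are equal to lambda_0. *)

Section moment.
Set Implicit Arguments.
Unset Strict Implicit.
Variables (R : comNzRingType) (g : nat -> R).
Implicit Types p q : {poly R}.

Definition moment p : R := \sum_(i < size p) p`_i * g i.

Lemma moment_wide n p : (size p <= n)%N -> moment p = \sum_(i < n) p`_i * g i.
Proof.
move=> pn; rewrite /moment (big_ord_widen n (fun i => p`_i * g i) pn) big_mkcond.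
by apply: eq_bigr => i _; case: ltnP => // pi; rewrite nth_default ?mul0r.
Qed.

Fact moment_linear : scalar moment.
Proof.
move=> a p q; pose n := maxn (size p) (size q).
have sp : (size p <= n)%N by rewrite leq_maxl.
have sq : (size q <= n)%N by rewrite leq_maxr.
have spq : (size (a *: p + q)%R <= n)%N.
  by rewrite (leq_trans (size_polyD _ _))// geq_max sq (leq_trans (size_scale_leq _ _)).
rewrite (moment_wide spq) (moment_wide sp) (moment_wide sq) mulr_sumr.
rewrite -big_split; apply: eq_bigr => i _ /=.
by rewrite coefD coefZ mulrDl mulrA.
Qed.

HB.instance Definition _ :=
  GRing.isLinear.Build R {poly R} R *%R moment moment_linear.

Lemma momentZ a p : moment (a *: p) = a * moment p.
Proof. exact: linearZ. Qed.

Lemma momentXn n : moment 'X^n = g n.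
Proof.
rewrite (@moment_wide n.+1) ?size_polyXn// big_ord_recr /= coefXn eqxx mul1r.
by rewrite big1 ?add0r// => i _; rewrite coefXn ltn_eqF ?mul0r.
Qed.

Lemma moment_mul m n p q : (size p <= m)%N -> (size q <= n)%N ->
  moment (p * q) = \sum_(i < m) \sum_(j < n) g (i + j)%N * p`_i * q`_j.
Proof.
move=> pm qn; rewrite -{1}(coefK p) -{1}(coefK q) !poly_def.
pose mon (s : {poly R}) i := s`_i *: 'X^i : {poly R}.
have wide k (s : {poly R}) : (size s <= k)%N ->
    \sum_(i < size s) s`_i *: 'X^i = \sum_(i < k) s`_i *: 'X^i.
  move=> sk; rewrite (big_ord_widen k (mon s) sk) big_mkcond.
  by apply: eq_bigr => i _; case: ltnP => // si; rewrite nth_default ?scale0r.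
rewrite (wide _ _ pm) (wide _ _ qn) mulr_suml linear_sum; apply: eq_bigr => i _.
rewrite mulr_sumr linear_sum; apply: eq_bigr => j _ /=.
rewrite -scalerAl -scalerAr -exprD !momentZ momentXn.
by rewrite mulrA mulrC mulrA.
Qed.

Lemma moment_horner a n p : (forall i, (i < n)%N -> g i = a ^+ i) ->
  (size p <= n)%N -> moment p = p.[a].
Proof.
move=> ga pn; rewrite (moment_wide pn) (horner_coef_wide _ pn).
by apply: eq_bigr => i _; rewrite ga.
Qed.

End moment.

Section cpd_sequences.
Set Implicit Arguments.
Unset Strict Implicit.
Variables (R : realType) (g : R^nat).
Hypothesis g_cpd : cpd_seq g.
Implicit Types p q : {poly R}.

Lemma cpd_moment_ge0 p : p.[1] = 0 -> 0 <= moment g (p * p).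
Proof.
move=> p1; have sp : (size p <= (size p).+1)%N by [].
have sum0 : \sum_(i < (size p).+1) (p`_i)%:C = 0.
  rewrite -(rmorph_sum (real_complex R)) /= -[RHS](rmorph0 (real_complex R)).
  congr (_%:C); rewrite -[RHS]p1 (horner_coef_wide _ sp).
  by apply: eq_bigr => i _; rewrite expr1n mulr1.
have := g_cpd sum0; rewrite -lecR (moment_mul g sp sp).
congr (0 <= _); rewrite (rmorph_sum (real_complex R)); apply: eq_bigr => i _.
rewrite (rmorph_sum (real_complex R)); apply: eq_bigr => j _ /=.
by rewrite !rmorphM; congr (_ * _); exact: conjc_real.
Qed.

(** L((t p + q)^2) = 2 t L(p q) + L(q^2) is affine in t and bounded below, so
    its slope vanishes. *)
Lemma cpd_orthogonal p q : p.[1] = 0 -> q.[1] = 0 ->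
  moment g (p * p) = 0 -> moment g (p * q) = 0.
Proof.
move=> p1 q1 pp0; apply/eqP/negP => /negP pq_neq0.
set b := moment g (p * q) in pq_neq0; set c := moment g (q * q).
have affine_ge0 t : 0 <= 2 * t * b + c.
  have tpq1 : (t *: p + q).[1] = 0 by rewrite hornerD hornerZ p1 q1 mulr0 addr0.
  have := cpd_moment_ge0 tpq1.
  have -> : (t *: p + q) * (t *: p + q)
      = t ^+ 2 *: (p * p) + ((2 * t) *: (p * q) + q * q).
    by rewrite -!mul_polyC rmorphXn rmorphM /=; ring.
  by rewrite !linearD /= !momentZ pp0 mulr0 add0r.
(* at this t the affine function takes the value - 1 *)
have := affine_ge0 (- (c + 1) / (2 * b)).
have -> : 2 * (- (c + 1) / (2 * b)) * b + c = - 1 by field.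
lra.
Qed.

Lemma cpd_geometric a : (forall i, (i < 5)%N -> g i = a ^+ i) ->
  forall n, g n = a ^+ n.
Proof.
move=> ga.
pose p : {poly R} := ('X - 1%:P) * ('X - a%:P).
have p1 : p.[1] = 0 by rewrite hornerM hornerXsubC subrr mul0r.
have pa : p.[a] = 0 by rewrite hornerM !hornerXsubC subrr mulr0.
have size_p : size p = 3 by rewrite size_Mmonic ?monicXsubC ?polyXsubC_eq0 ?size_XsubC.
have size_pp : (size (p * p)%R <= 5)%N.
  by rewrite (leq_trans (size_polyMleq _ _))// size_p.
have pp0 : moment g (p * p) = 0.
  by rewrite (moment_horner ga size_pp) hornerM pa mulr0.
have rec n : g n.+3 = (2 + a) * g n.+2 - (1 + 2 * a) * g n.+1 + a * g n.
  have q1 : ('X^n * ('X - 1%:P) : {poly R}).[1] = 0.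
    by rewrite hornerM hornerXsubC subrr mulr0.
  have := cpd_orthogonal p1 q1 pp0.
  have -> : p * ('X^n * ('X - 1%:P)) = 'X^(n.+3)
      - (2 + a) *: 'X^(n.+2) + (1 + 2 * a) *: 'X^(n.+1) - a *: 'X^n.
    rewrite /p -!mul_polyC !rmorphD !rmorphM /= !rmorph1 !exprS.
    by rewrite (rmorph_nat (@polyC R) 2); ring.
  rewrite linearB linearD linearB /= !momentZ !momentXn; lra.
suff ind n : [/\ g n = a ^+ n, g n.+1 = a ^+ n.+1 & g n.+2 = a ^+ n.+2].
  by move=> n; have [] := ind n.
elim: n => [|n [g0 g1 g2]]; first by split; exact: ga.
by split=> //; rewrite rec g0 g1 g2 !exprS; ring.
Qed.

End cpd_sequences.

Section orbit.
Set Implicit Arguments.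
Unset Strict Implicit.
Variables (R : realType) (l : R^nat) (lb : bounded_fun l).

Lemma iter_wshift_basis0 n :
  iter n (wshift lb) (l2_basis 0%N) = (\prod_(i < n) l i)%:C *: l2_basis n.
Proof.
elim: n => [|n IHn]; first by rewrite big_ord0 scale1r.
by rewrite iterS IHn linearZ /= wshift_basis scalerA -rmorphM big_ord_recr.
Qed.

Lemma l2_norm_basis n : l2_norm (l2_basis n : l2 R) = 1.
Proof.
have basis_coord : Normc.normc ((l2_basis n : l2 R) n) = 1.
  by rewrite /= eqxx /= expr1n expr0n addr0 sqrtr1.
apply/eqP; rewrite eq_le -{2}basis_coord l2_norm_coord andbT.
apply: l2_norm_le => // m; rewrite expr1n /series /=.
have sqmod_basis k : sqmod (l2_basis n : l2 R) k = (k == n)%:R.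
  by rewrite sqmodE /=; case: eqP => _ /=; rewrite ?expr1n expr0n addr0.
under eq_bigr do rewrite sqmod_basis.
have [nm|mn] := ltnP n m.
  rewrite (bigD1_seq n) ?mem_index_iota ?iota_uniq//= eqxx.
  by rewrite big1 ?addr0// => i /negbTE ->.
by rewrite big_nat big1 ?ler01// => i /andP[_ im]; rewrite ltn_eqF ?(leq_trans im).
Qed.

Lemma sqnorm_iter_wshift_basis0 n :
  complex.Re `|iter n (wshift lb) (l2_basis 0%N)| ^+ 2 = (\prod_(i < n) l i) ^+ 2.
Proof.
rewrite iter_wshift_basis0 /Num.norm /= l2_normZ l2_norm_basis mulr1 /=.
by rewrite expr0n addr0 sqr_sqrtr ?sqr_ge0.
Qed.

End orbit.

Lemma eq_geometric_prod (R : realType) (l : R^nat) c : 0 < c ->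
  (forall n, \prod_(i < n) l i = c ^+ n) -> forall n, l n = c.
Proof.
move=> c0 lc n; have := lc n.+1.
by rewrite big_ord_recr lc exprSr /= => /(mulfI _); apply; rewrite expf_neq0 ?gt_eqF.
Qed.

Theorem theorem8p3 (R : realType) (lambda : R^nat)
    (lambda_gt0 : forall n, 0 < lambda n) (lambda_bounded : bounded_fun lambda)
    (W_cpd : cpd_operator (wshift lambda_bounded))
    (lambda01 : lambda 0%N = lambda 1%N) (lambda12 : lambda 1%N = lambda 2%N)
    (lambda23 : lambda 2%N = lambda 3%N) (lambda3_neq1 : lambda 3%N <> 1) :
  (1 / lambda 0%N)%:C \*: wshift lambda_bounded = unilateral_shift R.
Proof.
set c := lambda 0%N.
have c_gt0 : 0 < c by exact: lambda_gt0.
have prod_lt5 i : (i < 5)%N -> \prod_(j < i) lambda j = c ^+ i.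
  move=> i5; rewrite -[i in RHS]card_ord -prodr_const; apply: eq_bigr => -[j ji] _ /=.
  have : (j < 4)%N by exact: leq_trans ji _.
  by rewrite /c; case: j {ji} => [|[|[|[|//]]]] _; rewrite ?lambda01 ?lambda12 ?lambda23.
have lambda_const : forall n, lambda n = c.
  apply: eq_geometric_prod => // n.
  have geom : (\prod_(i < n) lambda i) ^+ 2 = (c ^+ 2) ^+ n.
    rewrite -(sqnorm_iter_wshift_basis0 lambda_bounded).
    apply: (cpd_geometric (W_cpd (l2_basis 0%N))) => i i5.
    by rewrite sqnorm_iter_wshift_basis0 prod_lt5// exprAC.
  have prod_ge0 : 0 <= \prod_(i < n) lambda i by apply: prodr_ge0 => i _; exact: ltW.
  have cn_ge0 : 0 <= c ^+ n by rewrite exprn_ge0 ?ltW.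
  by apply/eqP; rewrite -(@eqrXn2 _ 2 _ _ isT prod_ge0 cn_ge0) geom exprAC.
apply/funext => x; apply: l2_ext => -[|n].
  by transitivity ((1 / c)%:C * 0 : R[i]) => //; rewrite mulr0.
transitivity ((1 / c)%:C * ((lambda n)%:C * x n)) => //.
transitivity (1%:C * x n) => //.
by rewrite lambda_const mulrA -rmorphM mul1r mulVf ?gt_eqF.
Qed.
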